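(* Let $S$ and $\Sigma$ be compact metric spaces with countable bases, and suppose that $\Sigma$ is a topological semigroup acting continuously on $S$. Let $(\mu_k)_{k\in-\mathbb{N}}$ be a sequence of laws on $\Sigma$, and let $(N_k)_{k\in-\mathbb{N}}$ be a sequence of independent random variables such that $N_k$ has law $\mu_k$ for each $k\in-\mathbb{N}$. Suppose that the infinite product $$\Phi_k=\lim_{l\to-\infty}N_kN_{k-1}\cdots N_{l+1}$$ converges almost surely for each $k\in-\mathbb{N}$. (Then for each $x\in S$ the process $\{(\Phi_kx)_{k\in-\mathbb{N}},(N_k)_{k\in-\mathbb{N}}\}$ is a strong solution of the stochastic equation $X_k=N_kX_{k-1}$, $k\in-\mathbb{N}$.) Then there exist a compact Hausdorff space $T$ with a countable base, a continuous onto mapping $\pi:S\to T$ and a measurable section $\psi:T\to S$ of $\pi$ (i.e., $\pi\circ\psi$ is the identity) which satisfy the following conditions: (i) for any two distinct elements $y_1,y_2\in T$, the solutions $\{(\Phi_kx)_{k\in-\mathbb{N}},(N_k)_{k\in-\mathbb{N}}\}$ for $x=\psi(y_1)$ and $x=\psi(y_2)$ are distinct; (ii) the solutions $\{(\Phi_kx)_{k\in-\mathbb{N}},(N_k)_{k\in-\mathbb{N}}\}$ for $x=\psi(y)$ with $y$ running over $T$ exhaust all strong solutions; (iii) any solution $\{(X_k)_{k\in-\mathbb{N}},(N_k)_{k\in-\mathbb{N}}\}$ is equal to $$\{(\Phi_k\psi(\Xi))_{k\in-\mathbb{N}},(N_k)_{k\in-\mathbb{N}}\}$$ for some $T$-valued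 random variable $\Xi$ which is independent of $(N_k)_{k\in-\mathbb{N}}$.
   Context: Notation: $\mathbb{N}=\{0,1,2,\ldots\}$ and $-\mathbb{N}=\{0,-1,-2,\ldots\}$. For $\sigma\in\Sigma$ and $x\in S$, $\sigma x$ denotes the action of $\sigma$ on $x$; it satisfies $(\sigma_1\sigma_2)x=\sigma_1(\sigma_2x)$. Solution: for a given sequence $(\mu_k)_{k\in-\mathbb{N}}$ of laws on $\Sigma$, a process $\{(X_k)_{k\in-\mathbb{N}},(N_k)_{k\in-\mathbb{N}}\}$, with $X_k$ taking values in $S$ and $N_k$ taking values in $\Sigma$, is called a solution of the equation $X_k=N_kX_{k-1}$ ($k\in-\mathbb{N}$) if it satisfies this equation and, for each $k\in-\mathbb{N}$, the random variable $N_k$ has law $\mu_k$ and is independent of $\sigma(X_j:j\le k-1)$. Two solutions are identified (regarded as equal) if their joint laws on $S^{-\mathbb{N}}\times\Sigma^{-\mathbb{N}}$ are equal; otherwise they are distinct. Strong solution: a solution is called strong if, for each $k\in-\mathbb{N}$, $X_k$ is measurable with respect to the past noise $N_k,N_{k-1},\ldots$ up to null sets; in other words, there exists a Borel function $f_k:\Sigma^{-\mathbb{N}}\to S$ such that $X_k=f_k(N_k,N_{k-1},\ldots)$ almost surely.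
   Formalization: In the definition of a solution, N_k is required to be independent of σ(X_j, N_j : j ≤ k−1), not only of σ(X_j : j ≤ k−1); under the weaker condition (ii) and (iii) fail (e.g. S a point, Σ a two-point left-zero semigroup, all N_k equal). S is taken nonempty. *)

(* Defs.v *)
From HB Require Import structures.
From mathcomp Require Import all_boot all_order all_algebra finmap.
From mathcomp Require Import all_classical all_reals all_analysis.

Set Implicit Arguments.
Unset Strict Implicit.
Unset Printing Implicit Defensive.

Import Order.TTheory GRing.Theory Num.Theory.
Local Open Scope classical_set_scope.
Local Open Scope ring_scope.

(* The index set -N = {0, -1, -2, ...} is encoded by nat: the natural number k
   stands for the time -k, so that the time preceding k is k.+1 and the past of
   k is made of the indices j > k. *)

(* Measurable types carry a distinguished point, hence so do the metric spaces
   below; this only excludes the empty space. *)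
#[short(type="pmetricType")]
HB.structure Definition PMetric (K : numDomainType) :=
  {M of Metric K M & Pointed M}.

Notation borel T := (g_sigma_algebraType (@open T)).

(* sequence_space E is E^(-N) with its product sigma-algebra. *)
Definition cylinders d (E : measurableType d) : set (set (nat -> E)) :=
  \bigcup_k preimage_set_system [set: nat -> E] (fun u => u k) measurable.

Notation sequence_space E := (g_sigma_algebraType (@cylinders _ E)).

Section probability_notions.
Context d (Omega : measurableType d) (R : realType) (P : probability Omega R).

Definition has_law d1 (E : measurableType d1) (Y : Omega -> E)
    (nu : probability E R) : Prop :=
  measurable_fun [set: Omega] Y /\
  forall A, measurable A -> pushforward P Y A = nu A.

Definition independent_classes (F G : set (set Omega)) : Prop :=
  forall A B, F A -> G B -> P (A `&` B) = (P A * P B)%E.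

Definition sigma_of d1 (E : measurableType d1) (Y : Omega -> E) :
  set (set Omega) := preimage_set_system [set: Omega] Y measurable.

Definition mutually_independent d1 (E : measurableType d1)
    (Y : nat -> Omega -> E) : Prop :=
  forall (J : {fset nat}) (B : nat -> set E), (forall j, measurable (B j)) ->
    P (\bigcap_(j in [set` J]) Y j @^-1` B j) =
    (\prod_(j <- J) P (Y j @^-1` B j))%E.

End probability_notions.

Definition trajectory (Omega E : Type) (Y : nat -> Omega -> E) (w : Omega) :
  nat -> E := fun k => Y k w.

Definition same_law d1 d2 d3 (Omega1 : measurableType d1)
    (Omega2 : measurableType d2) (E : measurableType d3) (R : realType)
    (P1 : probability Omega1 R) (P2 : probability Omega2 R)
    (Y1 : Omega1 -> E) (Y2 : Omega2 -> E) : Prop :=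
  forall A, measurable A -> pushforward P1 Y1 A = pushforward P2 Y2 A.

Section stochastic_equation.
Context (R : realType) (S Sigma : pmetricType R).
Variables (mul : Sigma -> Sigma -> Sigma) (act : Sigma -> S -> S).
Variable mu : nat -> probability (borel Sigma) R.

Definition topological_semigroup : Prop :=
  associative mul /\ continuous (fun p : Sigma * Sigma => mul p.1 p.2).

Definition continuous_action : Prop :=
  (forall a b x, act (mul a b) x = act a (act b x)) /\
  continuous (fun p : Sigma * S => act p.1 p.2).

(* s_k s_{k-1} ... s_{k-m}, in the time convention of -N. *)
Fixpoint backward_prod (s : nat -> Sigma) (k m : nat) : Sigma :=
  if m is m'.+1 then mul (backward_prod s k m') (s (k + m)%N) else s k.

(* The infinite product; it is the default point of Sigma when the products
   diverge. *)
Definition Phi (s : nat -> Sigma) (k : nat) : Sigma :=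
  limn (backward_prod s k).

Section on_a_probability_space.
Context d (Omega : measurableType d) (P : probability Omega R).

Definition driving_noise (N : nat -> Omega -> borel Sigma) : Prop :=
  (forall k, has_law P (N k) (mu k)) /\ mutually_independent P N.

(* sigma(X_j, N_j : j <= k - 1), in the time convention of -N *)
Definition past (X : nat -> Omega -> borel S) (N : nat -> Omega -> borel Sigma)
    (k : nat) : set (set Omega) :=
  <<s \bigcup_(j in [set j | (k < j)%N]) (sigma_of (X j) `|` sigma_of (N j)) >>.

(* The noise at time k is independent of the past of the pair (X, N). When
   Sigma is a group acting on S = Sigma by translations, the past of X already
   contains that of N. For a general action it does not, and independence from
   the past of X alone would not even make the noise an independent sequence
   (take S a singleton). *)
Record solution (X : nat -> Omega -> borel S)
    (N : nat -> Omega -> borel Sigma) : Prop := Solution {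
  solution_measurable : forall k, measurable_fun [set: Omega] (X k) ;
  solution_law : forall k, has_law P (N k) (mu k) ;
  solution_indep : forall k,
    independent_classes P (sigma_of (N k)) (past X N k) ;
  solution_eq : forall k, {ae P, forall w, X k w = act (N k w) (X k.+1 w)}
}.

Definition strong_solution (X : nat -> Omega -> borel S)
    (N : nat -> Omega -> borel Sigma) : Prop :=
  solution X N /\
  forall k, exists f : sequence_space (borel Sigma) -> borel S,
    measurable_fun setT f /\
    {ae P, forall w, X k w = f (fun j => N (k + j)%N w)}.

Definition joint_trajectory (X : nat -> Omega -> borel S)
    (N : nat -> Omega -> borel Sigma) (w : Omega) :
    sequence_space (borel S) * sequence_space (borel Sigma) :=
  (trajectory X w, trajectory N w).

Definition Phi_process (N : nat -> Omega -> borel Sigma) (Y : Omega -> S) :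
    nat -> Omega -> borel S :=
  fun k w => act (Phi (trajectory N w) k) (Y w).

End on_a_probability_space.

Definition equal_solutions d1 d2 (Omega1 : measurableType d1)
    (Omega2 : measurableType d2) (P1 : probability Omega1 R)
    (P2 : probability Omega2 R)
    (X1 : nat -> Omega1 -> borel S) (N1 : nat -> Omega1 -> borel Sigma)
    (X2 : nat -> Omega2 -> borel S) (N2 : nat -> Omega2 -> borel Sigma) : Prop :=
  same_law P1 P2 (joint_trajectory X1 N1) (joint_trajectory X2 N2).

End stochastic_equation.

(* Main.v *)
Require Import Defs.
From mathcomp Require Import all_boot all_order all_algebra finmap.
From mathcomp Require Import all_classical all_reals all_analysis.

Set Implicit Arguments.
Unset Strict Implicit.
Unset Printing Implicit Defensive.

Import Order.TTheory GRing.Theory Num.Theory.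
Local Open Scope classical_set_scope.
Local Open Scope ring_scope.

(** Call two points of S equivalent when, almost surely, every Phi_k sends them
to the same point.  T is the quotient of S by this relation.

Everything rests on one pathwise observation.  If (X, N) is a solution then
X_k = N_k ... N_{l+1} X_l.  Along a subsequence of times l tending to minus
infinity X_l converges to some Z, by compactness, while the products converge
to Phi_k; hence X_k = Phi_k Z for all k at once.  The cluster point Z can be
chosen as a measurable function of the set of cluster points of the trajectory
of X [measurable_select], so that it depends only on the remote past: it is
measurable with respect to (X_l, N_l : l <= k) for every k, and is therefore
independent of the whole noise [solution_initial].

The relation is an almost sure membership in random closed subsets of S * S.
A countable dense part of the relation then suffices to find one null set
outside of which Phi_k identifies all equivalent pairs simultaneously
[ae_subset_random_closed].  This shows that the relation is closed, so that T
is compact, Hausdorff and second countable [compact_quotient], and it allows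
Z to be replaced by psi (pi Z) inside Phi_k Z although Z is random: this is
(iii), with Xi = pi Z.  The section psi selects a point in each fibre of pi by
the same selection theorem as above [measurable_section].

For (i), Phi_k x is a function of the noise, so that the law of
((Phi_k x)_k, N) is carried by the graph of that function; two points with the
same law are equivalent.  For (ii), X_k = Phi_k Z is also some f_k(N); as Z
and N are independent, Fubini yields a deterministic x with f_k(N) = Phi_k x
almost surely [strong_solution_constant]. *)

(** * Compact second countable spaces *)

Section countable_base.
Context (E : topologicalType).

(** A countable base given as a sequence, possibly with repetitions. *)
Definition base_sequence (B : nat -> set E) : Prop :=
  (forall n, open (B n)) /\
  forall x U, open U -> U x -> exists n, B n x /\ B n `<=` U.

Lemma base_sequenceP :
  @second_countable E <-> exists B : nat -> set E, base_sequence B.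
Proof.
split=> [[C cC [oC bC]]|[B [oB bB]]].
  have [C0|C0] := eqVneq C set0.
    have noE (x : E) : False.
      by have [|U [+ _] _] := bC x setT; [exact: filterT|rewrite C0].
    by exists (fun=> set0); split=> [n|x]; [exact: open0|case: (noE x)].
  have [f fC] : exists f : nat -> set E, C = range f.
    have /set0P[U0 CU0] := C0.
    have := cC; rewrite /countable => /pfcard_geP[C0'|[f]].
      by rewrite C0' eqxx in C0.
    exists f; apply/seteqP; split => [U CU|_ [n _ <-]].
      by have [n _ <-] := @surj _ _ _ _ f U CU; exists n.
    exact: funS.
  exists f; split=> [n|x U oU Ux]; first by apply: oC; rewrite fC; exists n.
  have [|V [CV Vx] VU] := bC x U; first exact: open_nbhs_nbhs.
  by move: CV; rewrite fC => -[n _ fn]; exists n; rewrite fn.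
exists (range B); first exact: card_image_le.
split=> [_ [n _ <-]|x U]; first exact: oB.
rewrite nbhsE => -[V [oV Vx] VU]; have [n [Bx BV]] := bB x V oV Vx.
by exists (B n); [split=> //; exists n|exact: subset_trans VU].
Qed.

(** Finite unions of base elements are still countably many, and interpolate
between a compact set and an open set around it. *)
Lemma compact_interpolation (B : nat -> set E) : base_sequence B ->
  exists O : nat -> set E, (forall n, open (O n)) /\
    forall K U, compact K -> open U -> K `<=` U ->
      exists n, K `<=` O n /\ O n `<=` U.
Proof.
move=> [oB bB].
pose O n := \bigcup_(i in [set i | i \in odflt [::] (choice.unpickle n : option (seq nat))]) B i.
exists O; split=> [n|K U /compact_near_coveringP cK oU KU].
  by apply: bigcup_open => i _; exact: oB.
pose P m (x : E) := exists i, [/\ (i <= m)%N, B i x & B i `<=` U].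
have [x Kx|m _ /(_ m (leqnn m)) KP] := cK nat \oo P _.
  have [i [Bx BU]] := bB x U oU (KU _ Kx).
  exists (B i, [set m | (i <= m)%N]) => /=.
    by split; [exact: open_nbhs_nbhs|exists i].
  by move=> [y m] [/= By im]; exists i.
(* the code of those B i, i <= m, that lie in U *)
have [s sE] : exists s : seq nat,
    forall i, (i \in s) = `[< B i `<=` U >] && (i <= m)%N.
  by exists [seq i <- iota 0 m.+1 | `[< B i `<=` U >]] => i;
    rewrite mem_filter mem_iota.
exists (choice.pickle s); rewrite /O choice.pickleK /=.
split=> [x /KP[i [im Bx BU]]|x [i]].
  by exists i => //=; rewrite sE asboolT.
by rewrite /= sE => /andP[/asboolP BU _] /BU.
Qed.

End countable_base.

Lemma openX (E F : topologicalType) (U : set E) (V : set F) :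
  open U -> open V -> open (U `*` V).
Proof.
move=> oU oV; rewrite openE => -[x y] [/= Ux Vy].
by exists (U, V) => //; split; exact: open_nbhs_nbhs.
Qed.

Lemma second_countable_prod (E F : topologicalType) :
  @second_countable E -> @second_countable F -> @second_countable (E * F)%type.
Proof.
move=> /base_sequenceP[B [oB bB]] /base_sequenceP[C [oC bC]].
apply/base_sequenceP.
exists (fun n => let p := odflt (0%N, 0%N) (choice.unpickle n) in B p.1 `*` C p.2).
split=> [n|[x y] U oU Uxy]; first exact: openX.
have : nbhs (x, y) U by exact: open_nbhs_nbhs.
move=> [[V W] [/= Vx Wy] VWU].
move: Vx Wy; rewrite !nbhsE => -[V' [oV' V'x] V'V] [W' [oW' W'y] W'W].
have [i [Bx BV]] := bB _ _ oV' V'x; have [j [Cy CW]] := bC _ _ oW' W'y.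
exists (choice.pickle (i, j)); rewrite choice.pickleK /=; split=> //.
by move=> [a b] [/= /BV/V'V ? /CW/W'W ?]; exact: VWU.
Qed.

Lemma compact_bigcap_nonempty (E : topologicalType) (C : nat -> set E) :
  compact [set: E] -> (forall n, closed (C n)) -> (forall n, C n !=set0) ->
  (forall n, C n.+1 `<=` C n) -> \bigcap_n C n !=set0.
Proof.
move=> cE cC C0 dC; apply: contrapT => /forallNP nC.
have dCm i m : (i <= m)%N -> C m `<=` C i.
  move=> /subnK <-; elim: (m - i)%N => [//|k IH].
  by rewrite addSn; exact: subset_trans IH.
move: cE => /compact_near_coveringP/(_ nat \oo (fun m x => ~ C m x)).
case=> [x _|m _ /(_ m (leqnn m)) Cm].
  have /existsNP[i /not_implyP[_ nCi]] := nC x.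
  exists (~` C i, [set m | (i <= m)%N]) => /=.
    split; last by exists i.
    by apply: open_nbhs_nbhs; split=> //; exact: closed_openC.
  by move=> [y m] [/= nCy im] /(dCm _ _ im).
by have [x Cx] := C0 m; exact: (Cm x).
Qed.

Lemma measurable_open (E : ptopologicalType) d (Omega : measurableType d)
    (f : Omega -> borel E) :
  (forall U, open U -> measurable (f @^-1` U)) -> measurable_fun setT f.
Proof.
move=> fU; apply: (@measurability _ _ _ (borel E) _ _ open) => //.
by move=> _ [U oU <-]; rewrite setTI; exact: fU.
Qed.

(** * Measurable selection *)

Section selection.
Context (E : ptopologicalType) (B : nat -> set E).
Hypotheses (compactE : compact [set: E]) (hausdorffE : hausdorff_space E).
Hypothesis baseB : base_sequence B.

(** Shrink F by intersecting it successively with the complement of each base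
element, whenever this leaves a nonempty set.  What remains at the end is one
point: if x lies in B n and y does not, then x and y cannot both survive,
because a surviving y makes step n effective and this step discards x. *)
Fixpoint narrow (F : set E) (n : nat) : set E :=
  if n is m.+1 then
    if `[< narrow F m `\` B m !=set0 >] then narrow F m `\` B m else narrow F m
  else F.

(** The selected point is a function of the set F alone; the random cluster
point of a sequence inherits from this its invariance under shifts. *)
Definition select (F : set E) : E := get (\bigcap_n narrow F n).

Lemma narrow_closed F n : closed F -> closed (narrow F n).
Proof.
move=> cF; elim: n => //= n IH; case: asboolP => // _.
by rewrite setDE; apply: closedI => //; apply: open_closedC; exact: baseB.1.
Qed.

Lemma narrow_nonempty F n : F !=set0 -> narrow F n !=set0.
Proof. by move=> F0; elim: n => //= n IH; case: asboolP. Qed.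

Lemma narrowS F n : narrow F n.+1 `<=` narrow F n.
Proof. by move=> x /=; case: asboolP => // _ []. Qed.

Lemma narrow_eq F x y :
  (\bigcap_n narrow F n) x -> (\bigcap_n narrow F n) y -> x = y.
Proof.
move=> Fx Fy; apply: contrapT => /eqP xy.
have [A [oA /set_mem Ax /set_mem Ay]] := hausdorff_accessible hausdorffE xy.
have [n [Bx BA]] := baseB.2 x A oA Ax.
have := Fx n.+1 I; rewrite /=; case: asboolP => [_ []//|[]].
by exists y; split; [exact: Fy|move=> /BA].
Qed.

Lemma select_narrow F n : closed F -> F !=set0 -> narrow F n (select F).
Proof.
move=> cF F0; suff : (\bigcap_n narrow F n) (select F) by exact.
have [x Fx] : \bigcap_n narrow F n !=set0.
  apply: compact_bigcap_nonempty => // i; first exact: narrow_closed.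
  - exact: narrow_nonempty.
  - exact: narrowS.
exact: (getI Fx).
Qed.

Lemma select_in F : closed F -> F !=set0 -> F (select F).
Proof. exact: (@select_narrow F 0). Qed.

Lemma select_hits F K : closed F -> F !=set0 -> closed K ->
  K (select F) <-> forall n, narrow F n `&` K !=set0.
Proof.
move=> cF F0 cK; split=> [Ks n|FK].
  by exists (select F); split=> //; exact: select_narrow.
have [x Fx] : \bigcap_n (narrow F n `&` K) !=set0.
  apply: compact_bigcap_nonempty => // i.
    by apply: closedI => //; exact: narrow_closed.
  by move=> x [/narrowS].
rewrite (@narrow_eq F (select F) x) => [|n _|n _].
- by have [] := Fx 0 I.
- exact: select_narrow.
- by have [] := Fx n I.
Qed.

Section measurability.
Context d (Omega : measurableType d) (F : Omega -> set E).
Hypothesis hitF : forall K, closed K -> measurable [set w | F w `&` K !=set0].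

(** The property that all hitting events are measurable is preserved by
one step of shrinking, because a step only depends on whether a closed set is
hit. *)
Lemma measurable_narrow_hits n K : closed K ->
  measurable [set w | narrow (F w) n `&` K !=set0].
Proof.
elim: n K => [|n IH] K cK; first exact: hitF.
have cB : closed (~` B n) by apply: open_closedC; exact: baseB.1.
rewrite (_ : [set w | _] =
  [set w | narrow (F w) n `&` (~` B n `&` K) !=set0] `|`
  (~` [set w | narrow (F w) n `&` ~` B n !=set0] `&`
   [set w | narrow (F w) n `&` K !=set0])).
  apply: measurableU; first by apply: IH; exact: closedI.
  apply: measurableI; last exact: IH.
  by apply: measurableC; exact: IH.
apply/seteqP; split=> w /=; case: asboolP => FB.
- by move=> FBK; left; rewrite setIA -setDE.
- by right; split=> //; rewrite -setDE.
- by case=> [|[]]; rewrite ?setIA -setDE.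
- case=> [[x [Fx [nBx _]]]|[]//]; case: FB; exists x; split => //.
Qed.

(** A measurable selection theorem for compact-valued maps: by compactness the
selected point belongs to K if and only if every shrunken set hits K. *)
Lemma measurable_select : (forall w, closed (F w)) -> (forall w, F w !=set0) ->
  measurable_fun setT (select \o F : Omega -> borel E).
Proof.
move=> cF F0.
apply: measurable_open => U oU.
rewrite -[U]setCK -preimage_setC; apply: measurableC.
have cU : closed (~` U) by exact: open_closedC.
rewrite (_ : _ @^-1` _ = \bigcap_n [set w | narrow (F w) n `&` ~` U !=set0]).
  by apply: bigcap_measurableType => // n _; exact: measurable_narrow_hits.
apply/seteqP; split=> w.
  by move=> /(select_hits (cF w) (F0 w) cU) FU n _; exact: FU.
by move=> FU; apply/(select_hits (cF w) (F0 w) cU) => n; exact: FU.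
Qed.

End measurability.

End selection.

(** * Cluster points and limits of measurable sequences *)

Section cluster_points.
Context (E : topologicalType).
Implicit Type u : nat -> E.

Lemma cluster_seqP u x : cluster (u @ \oo) x <->
  forall U, open U -> U x -> forall m, exists2 l, (m <= l)%N & U (u l).
Proof.
rewrite clusterEonbhs; split=> [cx U oU Ux m|cx A U [m _ mA] [oU Ux]].
  have [|_ [[l ml <-] Ul]] := cx (u @` [set l | (m <= l)%N]) U _ (conj oU Ux).
    by exists m => // l ml; exists l.
  by exists l.
by have [l ml Ul] := cx U oU Ux m; exists (u l); split=> //; exact: mA.
Qed.

Lemma closed_cluster u : closed (cluster (u @ \oo)).
Proof. by rewrite clusterE; apply: closed_bigI => A _; exact: closed_closure. Qed.

(** Countably many conditions on the sequence decide whether a compact set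
contains a cluster point: if it contains none, compactness gives an open
neighbourhood of it that the sequence eventually avoids, and the latter may be
taken in the countable family O. *)
Lemma cluster_hitsP (O : nat -> set E) u K : (forall n, open (O n)) ->
  (forall K U, compact K -> open U -> K `<=` U ->
     exists n, K `<=` O n /\ O n `<=` U) ->
  compact K ->
  cluster (u @ \oo) `&` K !=set0 <->
  forall n, K `<=` O n -> forall m, exists2 l, (m <= l)%N & O n (u l).
Proof.
move=> oO OK cK; split=> [[x [/cluster_seqP cx Kx]] n KO m|KO].
  by apply: cx => //; exact: KO.
apply: contrapT => /forallNP nK.
pose P m x := exists U, [/\ open U, U x & forall l, (m <= l)%N -> ~ U (u l)].
have /compact_near_coveringP/(_ nat \oo P) := cK.
case=> [x Kx|m _ /(_ m (leqnn m)) KP].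
  have := nK x => /not_andP[|//] /cluster_seqP/existsNP[U] /not_implyP[oU].
  move=> /not_implyP[Ux] /existsNP[m mU].
  exists (U, [set i | (m <= i)%N]) => /=.
    by split; [exact: open_nbhs_nbhs|exists m].
  move=> [y i] [/= Uy mi]; exists U; split=> // l il Ul.
  by apply: mU; exists l => //; exact: leq_trans il.
pose V := \bigcup_(U in [set U | open U /\ forall l, (m <= l)%N -> ~ U (u l)]) U.
have [|x /KP[U [oU Ux mU]]|n [KOn OV]] := OK K V cK.
- by apply: bigcup_open => U [].
- by exists U.
- by have [l ml /OV[U [_ /(_ l ml)]]] := KO n KOn m.
Qed.

End cluster_points.

Section measurable_limits.
Context (E : ptopologicalType).
Hypotheses (compactE : compact [set: E]) (hausdorffE : hausdorff_space E).
Hypothesis countableE : @second_countable E.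

Lemma cluster_nonempty (u : nat -> E) : cluster (u @ \oo) !=set0.
Proof. by have [x [_ cx]] := @compactE (u @ \oo) _ filterT; exists x. Qed.

Lemma cvg_cluster_eq (u : nat -> E) z x :
  u @ \oo --> z -> cluster (u @ \oo) x -> x = z.
Proof. by move=> uz /(cvg_cluster uz) /hausdorffE. Qed.

Lemma cluster_cvgn (u : nat -> E) z :
  cluster (u @ \oo) z -> (forall x, cluster (u @ \oo) x -> x = z) ->
  u @ \oo --> z.
Proof.
move=> cz uz; apply: (@compact_cluster_set1 _ _ _ setT) => //.
- exact: filterT.
- exact: filterT.
- by apply/seteqP; split=> // x ->.
Qed.

Section sequences_of_functions.
Context d (Omega : measurableType d) (f : nat -> Omega -> borel E).
Hypothesis mf : forall n, measurable_fun setT (f n).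

Let mf_open n U : open U -> measurable (f n @^-1` U).
Proof.
move=> oU; rewrite -[X in measurable X]setTI; apply: mf => //.
exact: sub_sigma_algebra.
Qed.

Lemma measurable_cluster_hits K : closed K ->
  measurable [set w | cluster ((f ^~ w : nat -> E) @ \oo) `&` K !=set0].
Proof.
move=> cK; have /base_sequenceP[B /compact_interpolation[Q [oQ QK]]] := countableE.
have kK : compact K by exact: subclosed_compact compactE _.
rewrite (_ : [set w | _] = \bigcap_(n in [set n | K `<=` Q n]) \bigcap_m
    \bigcup_(l in [set l | (m <= l)%N]) f l @^-1` Q n).
  apply: bigcap_measurableType => // n _; apply: bigcap_measurableType => // m _.
  by apply: bigcup_measurable => l _; exact: mf_open.
apply/seteqP; split=> w.
  move=> /(cluster_hitsP _ oQ QK kK) fw n KO m _.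
  by have [l ml ?] := fw n KO m; exists l.
move=> fw; apply/(cluster_hitsP _ oQ QK kK) => n KO m.
by have [l ml ?] := fw n KO m I; exists l.
Qed.

Lemma measurable_cluster_select (B : nat -> set E) : base_sequence B ->
  measurable_fun setT
    ((fun w => select B (cluster ((f ^~ w : nat -> E) @ \oo))) : Omega -> borel E).
Proof.
move=> bB; apply: measurable_select => //.
- exact: measurable_cluster_hits.
- by move=> w; exact: closed_cluster.
- by move=> w; exact: cluster_nonempty.
Qed.

(** The sequence diverges if and only if it has a cluster point other than the
selected one z, i.e. some base element B n contains z while a cluster point
lies outside B n. *)
Lemma measurable_cvgn : measurable [set w | cvgn (f ^~ w : nat -> E)].
Proof.
have /base_sequenceP[B bB] := countableE.
pose F w := cluster ((f ^~ w : nat -> E) @ \oo).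
pose z w := select B (F w).
have zF w : F w (z w).
  by apply: select_in => //; [exact: closed_cluster|exact: cluster_nonempty].
rewrite (_ : [set w | _] =
  ~` (\bigcup_n (z @^-1` B n `&` [set w | F w `&` ~` B n !=set0]))).
  apply: measurableC; apply: bigcup_measurable => n _; apply: measurableI.
    rewrite -[X in measurable X]setTI; apply: measurable_cluster_select => //.
    by apply: sub_sigma_algebra; exact: bB.1.
  by apply: measurable_cluster_hits; apply: open_closedC; exact: bB.1.
apply/seteqP; split=> w /=.
  move=> /[dup] cw /cvg_cluster_eq Fw [n _ [/= zB [x [Fx nBx]]]].
  by apply: nBx; rewrite (Fw _ Fx) -(Fw _ (zF w)).
move=> nF; apply/cvg_ex; exists (z w); apply: cluster_cvgn => [|x Fx].
  exact: zF.
apply: contrapT => /eqP; rewrite eq_sym => zx.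
have [A [oA /set_mem Az /set_mem Ax]] := hausdorff_accessible hausdorffE zx.
have [n [Bz BA]] := bB.2 _ A oA Az.
by apply: nF; exists n => //; split=> //; exists x; split=> // /BA.
Qed.

(** On the measurable event of convergence the limit is the selected cluster
point, and elsewhere it is a constant by convention. *)
Lemma measurable_limn :
  measurable_fun setT ((fun w => limn (f ^~ w : nat -> E)) : Omega -> borel E).
Proof.
have /base_sequenceP[B bB] := countableE.
have mz := measurable_cluster_select bB.
pose C := [set w | cvgn (f ^~ w : nat -> E)].
move=> _ A mA; rewrite setTI.
set z := (fun w => select B _) in mz.
rewrite (_ : _ @^-1` A = (C `&` z @^-1` A) `|` (~` C `&` (fun=> A point) )).
  apply: measurableU; apply: measurableI.
  - exact: measurable_cvgn.
  - by rewrite -[X in measurable X]setTI; exact: mz.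
  - by apply: measurableC; exact: measurable_cvgn.
  have [Ap|nAp] := pselect (A point).
    by rewrite (_ : (fun=> _) = setT) //; apply/seteqP; split.
  by rewrite (_ : (fun=> _) = set0) //; apply/seteqP; split.
have zE w : C w -> z w = limn (f ^~ w : nat -> E).
  move=> /cvg_cluster_eq; apply; apply: select_in => //.
    exact: closed_cluster.
  exact: cluster_nonempty.
apply/seteqP; split=> w /=.
  by have [Cw|nCw] := pselect (C w); [rewrite zE//; left|rewrite dvgP//; right].
by case=> -[Cw]; [rewrite zE|rewrite dvgP].
Qed.

End sequences_of_functions.
End measurable_limits.

Section measurable_pairs.
Context (E F : ptopologicalType).
Hypotheses (cE : @second_countable E) (cF : @second_countable F).
Context d (Omega : measurableType d) (f : Omega -> borel E) (g : Omega -> borel F).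
Hypotheses (mf : measurable_fun setT f) (mg : measurable_fun setT g).

(** Second countability is what makes the product of the Borel sigma-algebras
contain the open sets of the product. *)
Lemma measurable_pair_open (U : set (E * F)) : open U ->
  measurable [set w | U (f w, g w)].
Proof.
move: cE cF => /base_sequenceP[B [oB bB]] /base_sequenceP[C [oC bC]] oU.
rewrite (_ : [set w | _] =
  \bigcup_(p in [set p : nat * nat | B p.1 `*` C p.2 `<=` U])
    (f @^-1` B p.1 `&` g @^-1` C p.2)).
  rewrite bigcup_mkcond; apply: countable_bigcupT_measurable => // p.
  case: ifPn => // _; apply: measurableI; rewrite -[X in measurable X]setTI.
    by apply: mf => //; exact: sub_sigma_algebra.
  by apply: mg => //; exact: sub_sigma_algebra.
apply/seteqP; split=> w /=; last by case=> p /= BCU [? ?]; exact: BCU.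
move=> Uw; have : nbhs ((f w, g w) : E * F) U by apply: open_nbhs_nbhs; split.
move=> [[V W] [/= Vx Wy] VWU].
move: Vx Wy; rewrite !nbhsE => -[V' [oV' V'x] V'V] [W' [oW' W'y] W'W].
have [i [Bx BV]] := bB _ _ oV' V'x; have [j [Cy CW]] := bC _ _ oW' W'y.
exists (i, j) => //= -[a b] [/= /BV/V'V ? /CW/W'W ?]; exact: VWU.
Qed.

Lemma measurable_continuous2 (G : ptopologicalType) (h : E * F -> G) :
  continuous h -> measurable_fun setT ((fun w => h (f w, g w)) : Omega -> borel G).
Proof.
move=> /continuousP ch; apply: measurable_open => U oU.
exact: (measurable_pair_open (ch _ oU)).
Qed.

End measurable_pairs.

Lemma closed_agreement (E F : topologicalType) (f : E -> F) :
  hausdorff_space F -> continuous f ->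
  closed [set p : E * E | f p.1 = f p.2].
Proof.
move=> hF cf p clp; apply: contrapT => /eqP fp.
move: hF; rewrite open_hausdorff => /(_ _ _ fp).
move=> [[U V] /= [/set_mem Up /set_mem Vp] [oU oV /eqP UV]].
have [|q [/= fq [/= Uq Vq]]] := clp ((f @^-1` U) `*` (f @^-1` V)).
  exists (f @^-1` U, f @^-1` V) => //=.
  by split; apply: cf; exact: open_nbhs_nbhs.
suff : (U `&` V) (f q.1) by rewrite UV.
by split=> //; rewrite fq.
Qed.

Lemma measurable_eq (E : ptopologicalType) : @second_countable E ->
  hausdorff_space E -> forall d (Omega : measurableType d) (f g : Omega -> borel E),
  measurable_fun setT f -> measurable_fun setT g ->
  measurable [set w | f w = g w].
Proof.
move=> cE hE d Omega f g mf mg.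
rewrite (_ : [set w | _] = ~` [set w | (fun p : E * E => p.1 <> p.2) (f w, g w)]).
  apply: measurableC.
  apply: (@measurable_pair_open E E cE cE _ _ _ _ mf mg [set p : E * E | p.1 <> p.2]).
  exact: (closed_openC (closed_agreement hE (fun x => cvg_id))).
apply/seteqP; split=> w /=; first by move=> ->.
exact: contrapT.
Qed.

(** * Quotients of compact spaces *)

Section saturated_open_sets.
Context (S T : topologicalType) (pi : S -> T).
Hypotheses (compactS : compact [set: S]) (hausdorffS : hausdorff_space S).
Hypothesis cpi : continuous pi.
Hypothesis spi : forall y, exists x, pi x = y.
Hypothesis closed_image : forall K, closed K -> closed (pi @` K).

(** The points whose fibre lies in U: for a closed map these sets are open and
push a base of S down to T. *)
Definition tube (U : set S) : set T := ~` (pi @` (~` U)).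

Lemma open_tube U : open U -> open (tube U).
Proof. by move=> oU; apply: closed_openC; apply: closed_image; exact: open_closedC. Qed.

Lemma tubeP U y : tube U y <-> pi @^-1` [set y] `<=` U.
Proof.
split=> [Uy x /= xy|yU [x nUx xy]]; last exact: nUx (yU _ xy).
by apply: contrapT => nUx; apply: Uy; exists x.
Qed.

Lemma closed_image_set1 (y : T) : closed [set y].
Proof.
have [x <-] := spi y; rewrite -image_set1; apply: closed_image.
exact/accessible_closed_set1/hausdorff_accessible.
Qed.

Lemma closed_fibre (y : T) : closed (pi @^-1` [set y]).
Proof. by apply: closed_comp => [x _|]; [exact: cpi|exact: closed_image_set1]. Qed.

(** Two distinct fibres are disjoint closed sets, which normality of S separates
by open sets U and V; the tubes of U and V separate the points. *)
Lemma closed_image_hausdorff (R : realType) : hausdorff_space T.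
Proof.
rewrite open_hausdorff => y y' /eqP yy'.
have /(@normal_openP R) nS := compact_normal hausdorffS compactS.
have [|U [V [oU oV yU y'V UV0]]] :=
    nS _ _ (closed_fibre (y := y)) (closed_fibre (y := y')).
  by apply/seteqP; split=> // x [/= xy xy']; apply: yy'; rewrite -xy.
exists (tube U, tube V) => /=; first by rewrite !inE; split; exact/tubeP.
split; [exact: open_tube|exact: open_tube|].
apply/eqP/seteqP; split=> // z [/tubeP zU /tubeP zV].
have [x xz] := spi z; suff : (U `&` V) x by rewrite UV0.
by split; [exact: zU|exact: zV].
Qed.

(** Interpolating between a fibre, which is compact, and an open set requires the
countable family of finite unions of base elements, not just a base. *)
Lemma closed_image_second_countable : @second_countable S -> @second_countable T.
Proof.
move=> /base_sequenceP[B /compact_interpolation[Q [oQ QK]]].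
apply/base_sequenceP; exists (tube \o Q); split=> [n|y U oU Uy].
  exact: open_tube.
have oV : open (pi @^-1` U) by exact: (continuousP _).1.
have [||n [yQ QU]] := QK (pi @^-1` [set y]) _ _ oV.
- exact: subclosed_compact (@closed_fibre y) compactS _.
- by move=> x /= ->.
exists n; split; first exact/tubeP.
by move=> z /tubeP zQ; have [x xz] := spi z; rewrite -xz; exact/QU/zQ.
Qed.

End saturated_open_sets.

Section quotient.
Local Open Scope quotient_scope.

(** The projection is a closed map: the saturation of a closed set K is the
second projection of the part of the relation that lies over K, a compact
set. *)
Lemma compact_quotient (R : realType) (S : ptopologicalType)
    (e : S -> S -> Prop) :
  compact [set: S] -> hausdorff_space S -> @second_countable S ->
  (forall x, e x x) -> (forall x y, e x y -> e y x) ->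
  (forall x y z, e x y -> e y z -> e x z) ->
  closed [set p : S * S | e p.1 p.2] ->
  exists (T : ptopologicalType) (pi : S -> T),
    [/\ compact [set: T], hausdorff_space T & @second_countable T] /\
    [/\ continuous pi, (forall y, exists x, pi x = y) &
        forall x x', pi x = pi x' <-> e x x'].
Proof.
move=> cS hS scS e_refl e_sym e_trans cle.
pose r : rel S := fun x y => `[< e x y >].
have r_refl : reflexive r by move=> x; exact/asboolP.
have r_sym : ssrbool.symmetric r.
  by move=> x y; apply/asboolP/asboolP; exact: e_sym.
have r_trans : ssrbool.transitive r.
  by move=> y x z /asboolP xy /asboolP yz; apply/asboolP; exact: e_trans yz.
pose eR := EquivRel r r_refl r_sym r_trans.
pose T : ptopologicalType := quotient_topology {eq_quot eR}.
pose pi : S -> T := \pi_{eq_quot eR}.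
have cpi : continuous pi by exact: pi_continuous.
have spi y : exists x, pi x = y by exists (repr y); exact: reprK.
have piE x x' : pi x = pi x' <-> e x x'.
  split=> [/eqmodP/asboolP//|exx']; apply/eqmodP; exact/asboolP.
have closed_image K : closed K -> closed (pi @` K).
  move=> cK; rewrite -[_ @` _]setCK; apply: open_closedC.
  rewrite /open /= /quotient_open -/pi -preimage_setC; apply: closed_openC.
  rewrite (_ : pi @^-1` _ =
    snd @` ((K `*` [set: S]) `&` [set p : S * S | e p.1 p.2])).
    apply: compact_closed => //; apply: continuous_compact.
      by apply: continuous_subspaceT => p; exact: cvg_snd.
    apply: compact_closedI => //; apply: compact_setX => //.
    exact: subclosed_compact cS _.
  apply/seteqP; split=> x /=.
    by move=> [y Ky /piE eyx]; exists (y, x).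
  by move=> [[y z] [[/= Ky _] /= eyz] <-]; exists y => //; exact/piE.
exists T, pi; split; split=> //.
- have -> : [set: T] = pi @` setT.
    by apply/seteqP; split=> // y _; have [x <-] := spi y; exists x.
  by apply: continuous_compact => //; exact: continuous_subspaceT.
- exact: (closed_image_hausdorff cS).
- exact: (closed_image_second_countable cS).
Qed.

End quotient.

(** The points of T whose fibre hits a closed set K form the image of K, which is
closed, so the selection theorem applies to the fibres. *)
Lemma measurable_section (S T : ptopologicalType) (pi : S -> T) :
  compact [set: S] -> hausdorff_space S -> @second_countable S ->
  hausdorff_space T -> continuous pi -> (forall y, exists x, pi x = y) ->
  exists psi : borel T -> borel S,
    measurable_fun setT psi /\ forall y, pi (psi y) = y.
Proof.
move=> cS hS /base_sequenceP[B bB] hT cpi spi.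
pose F (y : borel T) := pi @^-1` [set y].
have cF y : closed (F y).
  apply: closed_comp => [x _|]; first exact: cpi.
  exact/accessible_closed_set1/hausdorff_accessible.
have F0 y : F y !=set0 by have [x xy] := spi y; exists x.
exists (select B \o F); split; last by move=> y; exact: (select_in cS _ (cF y)).
apply: measurable_select => // K cK.
rewrite (_ : [set y | _] = ~` (~` (pi @` K))).
  apply: measurableC; apply: sub_sigma_algebra; apply: closed_openC.
  apply: compact_closed => //; apply: continuous_compact.
    exact: continuous_subspaceT.
  exact: subclosed_compact cS _.
rewrite setCK; apply/seteqP; split=> y.
  by move=> [x [xy Kx]]; exists x.
by move=> [x Kx xy]; exists x.
Qed.

(** * Random closed sets *)

Section almost_sure_containment.
Context d (Omega : measurableType d) (R : realType).
Context (P : {measure set Omega -> \bar R}) (E : topologicalType).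
Hypothesis cE : @second_countable E.
Context (C : Omega -> set E).
Hypothesis closedC : forall w, closed (C w).

Let ae_mem : set E := [set p | {ae P, forall w, C w p}].

(** A single null set serves all the points, possibly uncountably many, that
almost surely belong to C w: it suffices to treat one such point in each base
element, since C w is closed. *)
Lemma ae_subset_random_closed : {ae P, forall w, ae_mem `<=` C w}.
Proof.
have /base_sequenceP[B [oB bB]] := cE.
have /choice[q qB] : forall n, exists p : option E,
    (forall y, p = Some y -> ae_mem y /\ B n y) /\
    (ae_mem `&` B n !=set0 -> p <> None).
  move=> n; have [[p [ap Bp]]|nB] := pselect (ae_mem `&` B n !=set0).
    by exists (Some p); split=> // y [<-].
  by exists None.
have : {ae P, forall w, forall n, if q n is Some p then C w p else True}.
  apply: ae_foralln => n; have := (qB n).1; case: (q n) => [p /(_ p erefl)[]|_] //.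
  exact: aeW.
apply: filterS => w Cq p ap; apply: contrapT => nCp.
have [n [Bp BC]] := bB p (~` C w) (closed_openC (@closedC w)) nCp.
have := Cq n; have [+ +] := qB n; case: (q n) => [y|_ Bn _].
  by move=> /(_ y erefl)[_ /BC].
by apply: Bn => //; exists p.
Qed.

Lemma closed_ae_mem : closed ae_mem.
Proof.
move=> p clp; apply: filterS ae_subset_random_closed => w sub.
by apply: closedC => A /clp[y [/sub Cy Ay]]; exists y.
Qed.

End almost_sure_containment.

(** * Laws of random sequences *)

Section sequence_spaces.
Context d (E : measurableType d).

Definition rectangle (B : nat -> set E) (k : nat) : set (nat -> E) :=
  [set u | forall j, (j < k)%N -> B j (u j)].

(** Sets constrained on an initial segment of coordinates, rather than on an
arbitrary finite set of them: closed under intersection, and adapted to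
inductions on time. *)
Definition rectangles : set (set (nat -> E)) :=
  [set A | exists B k, (forall j, measurable (B j)) /\ A = rectangle B k].

Lemma measurable_coord k :
  measurable_fun setT ((fun u => u k) : sequence_space E -> E).
Proof.
move=> _ A mA; rewrite setTI; apply: sub_sigma_algebra.
by exists k => //; exists A => //; rewrite setTI.
Qed.

Lemma measurable_trajectory d' (Omega : measurableType d') (Y : nat -> Omega -> E) :
  (forall k, measurable_fun setT (Y k)) ->
  measurable_fun setT (trajectory Y : Omega -> sequence_space E).
Proof.
move=> mY.
apply: (@measurability _ _ _ (sequence_space E) _ _ (@cylinders _ E)) => //.
move=> _ [_ [k _ [A mA <-]] <-]; rewrite setTI setTI.
by rewrite -[X in measurable X]setTI; exact: mY.
Qed.

Lemma measurable_rectangle B k : (forall j, measurable (B j)) ->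
  measurable (rectangle B k : set (sequence_space E)).
Proof.
move=> mB; rewrite (_ : rectangle B k =
  \bigcap_(j in [set j | (j < k)%N]) (fun u : sequence_space E => u j) @^-1` B j).
  apply: bigcap_measurableType => j _.
  by rewrite -[X in measurable X]setTI; exact: measurable_coord.
by apply/seteqP; split=> u Bu j; exact: Bu.
Qed.

Lemma sequence_space_rectangles :
  @measurable _ (sequence_space E) = <<s rectangles >>.
Proof.
apply/seteqP; split; apply: smallest_sub.
- exact: smallest_sigma_algebra.
- move=> _ [k _ [A mA <-]]; apply: sub_sigma_algebra.
  exists (fun j => if j == k then A else setT), k.+1; split.
    by move=> j; case: ifP.
  apply/seteqP; split=> u /=.
    by move=> [_ Au] j _; case: eqP => // ->.
  by move=> /(_ k (ltnSn k)); rewrite eqxx.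
- exact: sigma_algebra_measurable.
- by move=> _ [B [k [mB ->]]]; exact: measurable_rectangle.
Qed.

Lemma rectangleI : setI_closed rectangles.
Proof.
move=> _ _ [B [k [mB ->]]] [C [l [mC ->]]].
exists (fun j => (if (j < k)%N then B j else setT) `&`
                 (if (j < l)%N then C j else setT)), (maxn k l); split.
  by move=> j; apply: measurableI; case: ifP.
apply/seteqP; split=> u /=.
  by move=> [Bu Cu] j _; split; case: ifP => // ?; [exact: Bu|exact: Cu].
move=> BCu; split=> j jk.
  by have := BCu j; rewrite leq_max jk => /(_ isT)[].
by have := BCu j; rewrite leq_max jk orbT => /(_ isT)[].
Qed.

Lemma measure_unique_rectangles (R : realType)
    (m1 m2 : {measure set (sequence_space E) -> \bar R}) :
  (m1 setT < +oo)%E ->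
  (forall B k, (forall j, measurable (B j)) ->
     m1 (rectangle B k) = m2 (rectangle B k)) ->
  forall A, measurable A -> m1 A = m2 A.
Proof.
move=> m1oo m12.
apply: (@measure_unique _ R (sequence_space E) (@rectangles) (fun=> setT)) => //.
- exact: sequence_space_rectangles.
- exact: rectangleI.
- move=> _; exists (fun=> setT), 0%N; split=> //.
  by apply/seteqP; split.
- by rewrite bigcup_const//; exists 0%N.
- by move=> _ [B [k [mB ->]]]; exact: m12.
Qed.

End sequence_spaces.

Lemma ae_exists d (Omega : measurableType d) (R : realType)
    (P : probability Omega R) (A : set Omega) : {ae P, forall w, A w} -> A !=set0.
Proof.
move=> aeA; apply: contrapT => A0.
have : P.-negligible setT.
  by apply: negligibleS aeA => w _ Aw; apply: A0; exists w.
move=> /(negligibleP _ measurableT) PT0; have := probability_setT P.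
by move=> /esym/eqP; rewrite PT0 onee_eq0.
Qed.

Lemma ae_probability1 d (Omega : measurableType d) (R : realType)
    (P : probability Omega R) (A : set Omega) : measurable A ->
  {ae P, forall w, A w} <-> P A = 1%E.
Proof.
move=> mA; have PC := probability_setC P mA; split.
  move=> /(negligibleP _ (measurableC mA)) PA0.
  have /eqP : (1 - P A = 0)%E by rewrite -PC; exact: PA0.
  by rewrite sube_eq ?fin_num_adde_defr// add0e => /eqP.
move=> PA; apply/(negligibleP _ (measurableC mA)).
by apply: etrans PC _; rewrite PA subee.
Qed.

Section random_sequences.
Context d (Omega : measurableType d) (R : realType) (P : probability Omega R).

Definition law d' (E : measurableType d') (f : Omega -> E)
    (mf : measurable_fun setT f) : probability E R :=
  distribution P (mfun_Sub (mem_set mf)).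

Lemma same_law_rectangles d' (E : measurableType d') d2
    (Omega2 : measurableType d2) (P2 : probability Omega2 R)
    (Y : nat -> Omega -> E) (Y2 : nat -> Omega2 -> E) :
  (forall k, measurable_fun setT (Y k)) ->
  (forall k, measurable_fun setT (Y2 k)) ->
  (forall B k, (forall j, measurable (B j)) ->
     P (trajectory Y @^-1` rectangle B k) = P2 (trajectory Y2 @^-1` rectangle B k)) ->
  same_law P P2 (trajectory Y : Omega -> sequence_space E) (trajectory Y2).
Proof.
move=> /measurable_trajectory mY /measurable_trajectory mY2 YY2 A mA.
pose m2 : probability (sequence_space E) R :=
  distribution P2 (mfun_Sub (mem_set mY2)).
apply: (@measure_unique_rectangles _ _ _ (law mY) m2) => //.
exact: (le_lt_trans (probability_le1 (law mY) measurableT) (ltry 1)).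
Qed.

(** Both sides are finite measures in A, so their agreement on rectangles
extends to all measurable sets. *)
Lemma independent_rectangles d' (E : measurableType d') (Y : nat -> Omega -> E) G :
  (forall k, measurable_fun setT (Y k)) -> measurable G ->
  (forall B k, (forall j, measurable (B j)) ->
     P (trajectory Y @^-1` rectangle B k `&` G) =
     (P (trajectory Y @^-1` rectangle B k) * P G)%E) ->
  forall A : set (sequence_space E), measurable A ->
    P (trajectory Y @^-1` A `&` G) = (P (trajectory Y @^-1` A) * P G)%E.
Proof.
move=> /measurable_trajectory mY mG YG A mA.
have PG : fine (P G) >= 0 by exact: fine_ge0.
have PGE : P G = (fine (P G))%:E by rewrite fineK// fin_num_measure.
(* a function of the proof that the map is measurable *)
pose image : {measure set (sequence_space E) -> \bar R} :=
  pushforward (mrestr P mG) (mfun_Sub (mem_set mY)).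
pose m1 := image mY.
pose m2 : {measure set (sequence_space E) -> \bar R} := mscale (NngNum PG) (law mY).
have m2E C : m2 C = (P (trajectory Y @^-1` C) * P G)%E.
  by rewrite muleC [in RHS]PGE.
have m1E C : m1 C = P (trajectory Y @^-1` C `&` G) by [].
rewrite -m2E -m1E; apply: measure_unique_rectangles => //.
  by rewrite m1E preimage_setT setTI PGE ltry.
by move=> B k mB; rewrite m1E m2E; exact: YG.
Qed.

(** Fubini: the law of (X, Y) is the product of the laws, so almost every
section of a set of full measure has full measure. *)
Lemma ae_independent_section d1 d2 (E1 : measurableType d1)
    (E2 : measurableType d2) (X : Omega -> E1) (Y : Omega -> E2) A :
  measurable_fun setT X -> measurable_fun setT Y ->
  (forall A1 A2, measurable A1 -> measurable A2 ->
     P (X @^-1` A1 `&` Y @^-1` A2) = (P (X @^-1` A1) * P (Y @^-1` A2))%E) ->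
  measurable A -> {ae P, forall w, A (X w, Y w)} ->
  exists x, {ae P, forall w, A (x, Y w)}.
Proof.
move=> mX mY XY mA aeA.
have mXY := measurable_fun_pair mX mY.
pose m1 := law mX; pose m2 := law mY.
have PA0 : P ((fun w => (X w, Y w)) @^-1` (~` A)) = 0%E.
  apply/negligibleP; last exact: aeA.
  by rewrite -[X in measurable X]setTI; apply: mXY => //; exact: measurableC.
have m12 : (m1 \x m2)%E (~` A) = 0%E.
  rewrite (@product_measure_unique _ _ _ _ _ m1 m2 (law mXY)).
  - exact: PA0.
  - by move=> A1 A2 mA1 mA2; rewrite -XY.
  - exact: measurableC.
have mf := measurable_fun_xsection m2 (measurableC mA).
have f0 : ae_eq m1 setT (m2 \o xsection (~` A)) (cst 0%E).
  apply/(ae_eq_integral_abs m1 measurableT mf); rewrite -[RHS]m12.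
  by apply: eq_integral => x _; rewrite gee0_abs.
have /ae_exists[x /(_ I) fx0] := f0.
exists x; apply: (@negligibleS _ _ _ _ (Y @^-1` xsection (~` A) x)).
  by move=> w /=; rewrite /xsection /= inE.
apply/negligibleP; last exact: fx0.
rewrite -[X in measurable X]setTI.
exact: (mY measurableT _ (measurable_xsection x (measurableC mA))).
Qed.

End random_sequences.

(** * Independence *)

Section independence.
Context d (Omega : measurableType d) (R : realType) (P : probability Omega R).

Lemma ae_eq_measure (A B : set Omega) : measurable A -> measurable B ->
  {ae P, forall w, A w <-> B w} -> P A = P B.
Proof.
move=> mA mB [C [mC PC0 ABC]].
rewrite -(measureU0 mA mC PC0) -(measureU0 mB mC PC0); congr (P _).
apply/seteqP; split=> w [|]; [|by right| |by right] => ABw.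
  have [Cw|nCw] := pselect (C w); [by right|left].
  by apply: contrapT => nB; apply: nCw; apply: ABC => /= -[/(_ ABw)].
have [Cw|nCw] := pselect (C w); [by right|left].
by apply: contrapT => nB; apply: nCw; apply: ABC => /= -[_ /(_ ABw)].
Qed.

Context d1 (E : measurableType d1) (Y : nat -> Omega -> E).

Lemma mutually_independent_seq (s : seq nat) (B : nat -> set E) :
  mutually_independent P Y -> (forall j, measurable (B j)) -> uniq s ->
  P [set w | forall j, j \in s -> B j (Y j w)] =
  (\prod_(j <- s) P (Y j @^-1` B j))%E.
Proof.
move=> iY mB us; pose J := [fset j in s]%fset.
have sJ : perm_eq s J.
  by apply: uniq_perm => [||j]; [|exact: fset_uniq|rewrite !inE].
rewrite (perm_big _ sJ) /= -iY//; congr (P _).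
apply/seteqP; split=> w Bw j /=.
  by rewrite (_ : (j \in J) = (j \in s)) ?inE//; exact: Bw.
by move=> js; apply: Bw => /=; rewrite !inE.
Qed.

Lemma mutually_independent_rectangle (B : nat -> set E) k :
  mutually_independent P Y -> (forall j, measurable (B j)) ->
  P (trajectory Y @^-1` rectangle B k) =
  (\prod_(0 <= j < k) P (Y j @^-1` B j))%E.
Proof.
move=> iY mB; rewrite -(mutually_independent_seq iY mB (iota_uniq _ _)).
by congr (P _); apply/seteqP; split=> w Bw j; have := Bw j;
  rewrite mem_index_iota.
Qed.

(** The variable at time k is independent of those at all earlier times, which
are indexed from k.+1 on. *)
Lemma mutually_independent_split (B : nat -> set E) k m A :
  mutually_independent P Y -> (forall j, measurable (B j)) -> measurable A ->
  P (trajectory (fun j => Y (k.+1 + j)%N) @^-1` rectangle B m `&` Y k @^-1` A) =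
  (P (trajectory (fun j => Y (k.+1 + j)%N) @^-1` rectangle B m) *
   P (Y k @^-1` A))%E.
Proof.
move=> iY mB mA.
(* the joint event as a single box over the indices k, ..., k + m *)
pose C j := if j == k then A else B (j - k.+1)%N.
have mC j : measurable (C j) by rewrite /C; case: ifP.
have Ck : C k = A by rewrite /C eqxx.
have CB j : C (k.+1 + j)%N = B j.
  by rewrite /C addKn -[X in _ == X]addn0 addSnnS eqn_add2l.
have rectE : trajectory (fun j => Y (k.+1 + j)%N) @^-1` rectangle B m =
    [set w | forall j, j \in iota k.+1 m -> C j (Y j w)].
  apply/seteqP; split=> w Bw j.
    rewrite mem_iota => /andP[kj jm]; have := Bw (j - k.+1)%N.
    by rewrite /trajectory -CB subnKC// ltn_subLR//; apply.
  by move=> jm; rewrite -CB; apply: Bw; rewrite mem_iota leq_addr ltn_add2l.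
rewrite rectE (mutually_independent_seq iY mC (iota_uniq _ _)) muleC.
rewrite -[X in (P (_ @^-1` X) * _)%E]Ck.
rewrite -(big_cons _ _ k (iota k.+1 m) xpredT (fun j => P (Y j @^-1` C j))).
rewrite -(mutually_independent_seq iY mC) ?(iota_uniq k m.+1)//.
congr (P _); apply/seteqP; split=> w /=.
  by move=> [Cw Aw] j; rewrite inE => /predU1P[->|/Cw//]; rewrite Ck.
move=> Cw; split=> [j jm|]; first by apply: Cw; rewrite inE jm orbT.
by rewrite -Ck; apply: Cw; rewrite inE eqxx.
Qed.

End independence.

Lemma cluster_shift (E : topologicalType) (u : nat -> E) k :
  cluster ((fun n => u (k + n)%N) @ \oo) = cluster (u @ \oo).
Proof.
apply/seteqP; split=> x /cluster_seqP cx; apply/cluster_seqP => U oU Ux m.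
  have [l ml Ul] := cx U oU Ux m; exists (k + l)%N => //.
  exact: leq_trans ml (leq_addl _ _).
have [l ml Ul] := cx U oU Ux (k + m)%N; exists (l - k)%N.
  by rewrite leq_subRL// (leq_trans _ ml)// leq_addr.
by rewrite subnKC// (leq_trans _ ml)// leq_addr.
Qed.

(** * The stochastic equation *)

Section equation.
Context (R : realType) (S Sigma : pmetricType R).
Hypotheses (compactS : compact [set: S]) (countableS : @second_countable S).
Hypotheses (compactSigma : compact [set: Sigma]).
Hypotheses (countableSigma : @second_countable Sigma).
Context (mul : Sigma -> Sigma -> Sigma) (act : Sigma -> S -> S).
Hypotheses (mulP : topological_semigroup mul) (actP : continuous_action mul act).

Let hausdorffS : hausdorff_space S := @metric_hausdorff R S.
Let hausdorffSigma : hausdorff_space Sigma := @metric_hausdorff R Sigma.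

Implicit Types s : nat -> Sigma.

Lemma backward_prod_shift s a b :
  backward_prod mul (fun i => s (a + i)%N) b = backward_prod mul s (a + b).
Proof. by apply/funext; elim=> //= m ->; rewrite addnA. Qed.

Lemma Phi_shift s a b : Phi mul (fun i => s (a + i)%N) b = Phi mul s (a + b).
Proof. by rewrite /Phi backward_prod_shift. Qed.

Lemma backward_prodS s k m :
  backward_prod mul s k m.+1 = mul (s k) (backward_prod mul s k.+1 m).
Proof.
elim: m => [|m IH]; first by rewrite /= addn1.
rewrite -[LHS]/(mul (backward_prod mul s k m.+1) (s (k + m.+2)%N)) IH.
by rewrite -mulP.1 addnS.
Qed.

Lemma Phi_step s k : cvgn (backward_prod mul s k) ->
  cvgn (backward_prod mul s k.+1) ->
  Phi mul s k = mul (s k) (Phi mul s k.+1).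
Proof.
move=> ck ck1; apply: cvg_lim => //; rewrite -cvg_shiftS.
under eq_fun => m do rewrite backward_prodS.
have : (s k, backward_prod mul s k.+1 m) @[m --> \oo] -->
    ((s k, Phi mul s k.+1) : Sigma * Sigma).
  by apply: cvg_pair => //=; exact: cvg_cst.
by move=> /(continuous_cvg _ (mulP.2 (s k, Phi mul s k.+1))).
Qed.

Lemma measurable_backward_prod k m :
  measurable_fun setT ((fun s => backward_prod mul s k m) :
    sequence_space (borel Sigma) -> borel Sigma).
Proof.
elim: m => [|m IH]; first exact: measurable_coord.
exact: (measurable_continuous2 countableSigma countableSigma IH
  (@measurable_coord _ (borel Sigma) (k + m.+1)) mulP.2).
Qed.

Lemma measurable_Phi k : measurable_fun setT ((fun s => Phi mul s k) :
  sequence_space (borel Sigma) -> borel Sigma).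
Proof. by apply: measurable_limn => // m; exact: measurable_backward_prod. Qed.

Lemma measurable_act d (Omega : measurableType d) (f : Omega -> borel Sigma)
    (g : Omega -> borel S) : measurable_fun setT f -> measurable_fun setT g ->
  measurable_fun setT ((fun w => act (f w) (g w)) : Omega -> borel S).
Proof.
by move=> mf mg; exact: (measurable_continuous2 countableSigma countableS mf mg actP.2).
Qed.

Lemma measurable_Phi_act d (Omega : measurableType d)
    (Y : Omega -> sequence_space (borel Sigma)) (X : Omega -> borel S) k :
  measurable_fun setT Y -> measurable_fun setT X ->
  measurable_fun setT ((fun w => act (Phi mul (Y w) k) (X w)) : Omega -> borel S).
Proof.
move=> mY mX; apply: measurable_act => //.
exact: (measurableT_comp (measurable_Phi k) mY).
Qed.

Lemma continuous_act_r a : continuous (act a).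
Proof.
move=> x; apply: (@continuous_comp _ _ _ (fun x => (a, x)) (fun p => act p.1 p.2)).
  by apply: cvg_pair => //=; exact: cvg_cst.
exact: actP.2.
Qed.

(** The relation x = b_m y_m passes to the limit of b_m and to any cluster point
of y_m, by joint continuity of the action. *)
Lemma act_cluster (b : nat -> Sigma) (y : nat -> S) a x z :
  b @ \oo --> a -> cluster (y @ \oo) z -> (forall m, x = act (b m) (y m)) ->
  x = act a z.
Proof.
move=> ba cz xE; apply: contrapT => /eqP xaz.
move: hausdorffS; rewrite open_hausdorff => /(_ _ _ xaz).
move=> [[U V] /= [/set_mem Ux /set_mem Vaz] [oU oV /eqP UV]].
have [[A C] /= [Aa Cz] ACV] : nbhs (a, z) [set p : Sigma * S | V (act p.1 p.2)].
  by apply: (actP.2 (a, z)); exact: open_nbhs_nbhs.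
have [m _ mA] := ba _ Aa.
move: Cz; rewrite nbhsE => -[C' [oC' C'z] C'C].
have [l ml Cl] := (cluster_seqP _ _).1 cz C' oC' C'z m.
suff : (U `&` V) x by rewrite UV.
split=> //; rewrite (xE l); apply: (ACV (b l, y l)); split=> /=; first exact: mA.
exact: C'C.
Qed.

Section on_a_space.
Context (mu : nat -> probability (borel Sigma) R).
Context d (Omega : measurableType d) (P : probability Omega R).
Implicit Types (N : nat -> Omega -> borel Sigma) (X : nat -> Omega -> borel S).

Lemma sigma_of_preimage d1 (E : measurableType d1) (Y : Omega -> E) A :
  measurable A -> sigma_of Y (Y @^-1` A).
Proof. by move=> mA; exists A => //; rewrite setTI. Qed.

(** Generators of the sigma-algebra of the pair up to time k included: the past
of k is the sigma-algebra generated by tail k.+1. *)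
Definition tail X N k : set (set Omega) :=
  \bigcup_(j in [set j | (k <= j)%N]) (sigma_of (X j) `|` sigma_of (N j)).

Lemma tailS X N k : <<s tail X N k.+1 >> `<=` <<s tail X N k >>.
Proof.
apply: smallest_sub; first exact: smallest_sigma_algebra.
move=> A [j kj jA]; apply: sub_sigma_algebra.
by exists j => //; exact: ltnW.
Qed.

Lemma tail_measurable X N k : (forall j, measurable_fun setT (X j)) ->
  (forall j, measurable_fun setT (N j)) -> <<s tail X N k >> `<=` measurable.
Proof.
move=> mX mN; apply: smallest_sub; first exact: sigma_algebra_measurable.
by move=> A [j _ [] [C mC <-]]; [exact: mX|exact: mN].
Qed.

Lemma noise_measurable N : (forall k, has_law P (N k) (mu k)) ->
  forall k, measurable_fun setT (N k).
Proof. by move=> lN k; have [] := lN k. Qed.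

Section solutions.
Variables (X : nat -> Omega -> borel S) (N : nat -> Omega -> borel Sigma).
Hypothesis XN : solution act mu P X N.

Let mX := solution_measurable XN.
Let mN := noise_measurable (solution_law XN).

(** By induction on k, peeling off the noise at the oldest time: the event that
it lies in B k joins G to form an event of tail k, and it is independent of G,
an event of tail k.+1, by the definition of a solution. *)
Lemma solution_rectangle B k G : (forall j, measurable (B j)) ->
  <<s tail X N k >> G ->
  P (trajectory N @^-1` rectangle B k `&` G) =
  ((\prod_(0 <= j < k) P (N j @^-1` B j)) * P G)%E.
Proof.
move=> mB; elim: k G => [|k IH] G tG.
  rewrite big_nil mul1e; congr (P _); apply/seteqP; split=> w; first by case.
  by split.
have tNG : <<s tail X N k >> (N k @^-1` B k `&` G).
  apply: (@measurableI _ (g_sigma_algebraType (tail X N k))); last exact: tailS.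
  by apply: sub_sigma_algebra; exists k => //=; right; exact: sigma_of_preimage.
rewrite big_nat_recr//= -muleA.
rewrite -(solution_indep XN (sigma_of_preimage (N k) (mB k)) tG) -(IH _ tNG).
congr (P _); apply/seteqP; split=> w /=.
  move=> [Bw Gw]; split=> [j jk|]; first by apply: Bw; exact: ltnW.
  by split=> //; apply: Bw.
move=> [Bw [Bk Gw]]; split=> // j; rewrite ltnS leq_eqVlt.
by move=> /predU1P[->|/Bw].
Qed.

Lemma solution_driving_noise : driving_noise mu P N.
Proof.
split=> [|J B mB]; first exact: solution_law XN.
pose k := (\max_(j <- J) j.+1)%N.
have Jk j : j \in J -> (j < k)%N.
  by move=> jJ; rewrite /k (big_rem j)//= leq_max leqnn.
(* an arbitrary finite set of indices, padded to an initial segment *)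
pose C j := if j \in J then B j else setT.
have mC j : measurable (C j) by rewrite /C; case: ifP.
have t0 : <<s tail X N k >> [set: Omega].
  exact: (@measurableT _ (g_sigma_algebraType (tail X N k))).
have := solution_rectangle mC t0.
rewrite probability_setT mule1 setIT => Ck.
transitivity (P (trajectory N @^-1` rectangle C k)).
  congr (P _); apply/seteqP; split=> w Bw j; rewrite /trajectory.
    by rewrite /C; case: ifP => // jJ _; exact: Bw.
  by move=> /= jJ; have := Bw j (Jk j jJ); rewrite /C jJ.
rewrite Ck (bigID (mem J)) /= [X in (_ * X)%E]big1 ?mule1; last first.
  by move=> j /negbTE jJ; rewrite /C jJ preimage_setT probability_setT.
rewrite -big_filter; have sJ : perm_eq [seq j <- index_iota 0 k | j \in J] J.
  apply: uniq_perm => [||j]; [|exact: fset_uniq|].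
    by rewrite filter_uniq// iota_uniq.
  by rewrite mem_filter mem_index_iota /=; case: (boolP (j \in J)) => //= /Jk.
rewrite (perm_big _ sJ) /= [LHS]big_seq [RHS]big_seq.
by apply: eq_bigr => j jJ; rewrite /C jJ.
Qed.

Lemma solution_independent_tail d1 (E : measurableType d1) (Z : Omega -> E) :
  (forall k A, measurable A -> <<s tail X N k >> (Z @^-1` A)) ->
  forall A (C : set (sequence_space (borel Sigma))), measurable A -> measurable C ->
  P (Z @^-1` A `&` trajectory N @^-1` C) =
  (P (Z @^-1` A) * P (trajectory N @^-1` C))%E.
Proof.
move=> tZ A C mA mC; rewrite setIC muleC.
apply: independent_rectangles => //.
  exact: (tail_measurable mX mN (tZ 0%N A mA)).
move=> B k mB; rewrite (solution_rectangle mB (tZ k A mA)).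
rewrite mutually_independent_rectangle//.
exact: solution_driving_noise.2.
Qed.

Lemma solution_backward : {ae P, forall w, forall k m,
  X k w = act (backward_prod mul (trajectory N w) k m) (X (k.+1 + m)%N w)}.
Proof.
have : {ae P, forall w, forall k, X k w = act (N k w) (X k.+1 w)}.
  by apply: ae_foralln => k; exact: solution_eq XN k.
apply: filterS => w Xw k; elim=> [|m IH]; first by rewrite addn0 /= -Xw.
by rewrite IH /= actP.1 /trajectory -Xw addSn addnS.
Qed.

(** Every solution starts from a random point Z at time minus infinity, a cluster
point of X_l chosen as a function of the set of all cluster points.  That set
does not change when the trajectory is shifted, so Z is measurable with respect
to tail k for every k, hence independent of the noise. *)
Lemma solution_initial :
  {ae P, forall w, forall k, cvgn (backward_prod mul (trajectory N w) k)} ->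
  exists Z : Omega -> borel S,
  [/\ measurable_fun setT Z,
      forall A (C : set (sequence_space (borel Sigma))),
        measurable A -> measurable C ->
        P (Z @^-1` A `&` trajectory N @^-1` C) =
        (P (Z @^-1` A) * P (trajectory N @^-1` C))%E &
      {ae P, forall w, forall k,
         X k w = act (Phi mul (trajectory N w) k) (Z w)}].
Proof.
move=> cvgN.
have /base_sequenceP[B bB] := countableS.
pose Z w : borel S := select B (cluster ((X ^~ w : nat -> S) @ \oo)).
have tZ k A : measurable A -> <<s tail X N k >> (Z @^-1` A).
  move=> mA; pose Y n (w : g_sigma_algebraType (tail X N k)) := X (k + n)%N w.
  have mY n : measurable_fun setT (Y n : _ -> borel S).
    move=> _ C mC; apply: sub_sigma_algebra; exists (k + n)%N => /=.
      exact: leq_addr.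
    by left; exists C.
  have := @measurable_cluster_select _ compactS hausdorffS countableS _ _ _ mY _ bB.
  move=> /(_ measurableT _ mA); rewrite setTI; congr (<<s _ >> (_ @^-1` A)).
  by apply/funext => w; rewrite /Y (cluster_shift (X ^~ w : nat -> S)).
exists Z; split.
- move=> _ A mA; rewrite setTI.
  exact: (tail_measurable mX mN (tZ 0%N A mA)).
- by move=> A C; exact: solution_independent_tail.
apply: filterS2 solution_backward cvgN => w XE cN k.
apply: (act_cluster (cN k) _ (XE k)).
rewrite (cluster_shift (X ^~ w : nat -> S)).
by apply: select_in => //; [exact: closed_cluster|exact: cluster_nonempty].
Qed.

End solutions.
End on_a_space.

Lemma measurable_joint d (Omega : measurableType d)
    (X : nat -> Omega -> borel S) (N : nat -> Omega -> borel Sigma) :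
  (forall k, measurable_fun setT (X k)) ->
  (forall k, measurable_fun setT (N k)) ->
  measurable_fun setT (joint_trajectory X N).
Proof.
by move=> mX mN; apply: measurable_fun_pair; exact: measurable_trajectory.
Qed.

Lemma measurable_Phi_process d (Omega : measurableType d)
    (N : nat -> Omega -> borel Sigma) (Y : Omega -> borel S) k :
  (forall j, measurable_fun setT (N j)) -> measurable_fun setT Y ->
  measurable_fun setT (Phi_process mul act N Y k).
Proof.
move=> mN mY; apply: (measurable_Phi_act (Y := trajectory N)) => //.
exact: measurable_trajectory.
Qed.

Lemma ae_equal_solutions d (Omega : measurableType d) (P : probability Omega R)
    (X X' : nat -> Omega -> borel S) (N : nat -> Omega -> borel Sigma) :
  (forall k, measurable_fun setT (X k)) ->
  (forall k, measurable_fun setT (X' k)) ->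
  (forall k, measurable_fun setT (N k)) ->
  {ae P, forall w, forall k, X k w = X' k w} -> equal_solutions P P X N X' N.
Proof.
move=> mX mX' mN XX' A mA; apply: ae_eq_measure.
- by rewrite -[X in measurable X]setTI; exact: measurable_joint.
- by rewrite -[X in measurable X]setTI; exact: measurable_joint.
apply: filterS XX' => w Xw.
have XE : joint_trajectory X N w = joint_trajectory X' N w.
  by congr pair; apply/funext => k; exact: Xw.
by rewrite /preimage /mkset XE.
Qed.

Lemma measurable_act_graph d (Omega : measurableType d)
    (Y : Omega -> sequence_space (borel Sigma)) (X : Omega -> borel S)
    (Z : nat -> Omega -> borel S) :
  measurable_fun setT Y -> measurable_fun setT X ->
  (forall k, measurable_fun setT (Z k)) ->
  measurable [set w | forall k, Z k w = act (Phi mul (Y w) k) (X w)].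
Proof.
move=> mY mX mZ; rewrite (_ : [set w | _] =
    \bigcap_k [set w | Z k w = act (Phi mul (Y w) k) (X w)]).
  apply: bigcapT_measurable => k; apply: measurable_eq => //.
  exact: measurable_Phi_act.
by apply/seteqP; split=> w Zw k => [_|]; exact: Zw.
Qed.

Section driving_noises.
Context (mu : nat -> probability (borel Sigma) R).

Lemma driving_noise_same_law d1 (Omega1 : measurableType d1)
    (P1 : probability Omega1 R) (N1 : nat -> Omega1 -> borel Sigma)
    d2 (Omega2 : measurableType d2) (P2 : probability Omega2 R)
    (N2 : nat -> Omega2 -> borel Sigma) :
  driving_noise mu P1 N1 -> driving_noise mu P2 N2 ->
  same_law P1 P2 (trajectory N1 : Omega1 -> sequence_space (borel Sigma))
                 (trajectory N2).
Proof.
move=> [l1 i1] [l2 i2]; apply: same_law_rectangles.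
- exact: noise_measurable l1.
- exact: noise_measurable l2.
move=> B k mB; rewrite !mutually_independent_rectangle//.
apply: eq_bigr => j _.
by have := (l1 j).2 _ (mB j); have := (l2 j).2 _ (mB j); rewrite /pushforward => -> ->.
Qed.

(** Almost sure properties of the noise do not depend on the probability space
that carries it. *)
Lemma driving_noise_ae d1 (Omega1 : measurableType d1)
    (P1 : probability Omega1 R) (N1 : nat -> Omega1 -> borel Sigma)
    d2 (Omega2 : measurableType d2) (P2 : probability Omega2 R)
    (N2 : nat -> Omega2 -> borel Sigma) (A : set (sequence_space (borel Sigma))) :
  driving_noise mu P1 N1 -> driving_noise mu P2 N2 -> measurable A ->
  {ae P1, forall w, A (trajectory N1 w)} -> {ae P2, forall w, A (trajectory N2 w)}.
Proof.
move=> n1 n2 mA.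
have mN1 : measurable (trajectory N1 @^-1` A).
  rewrite -[X in measurable X]setTI.
  exact: (measurable_trajectory (noise_measurable n1.1)).
have mN2 : measurable (trajectory N2 @^-1` A).
  rewrite -[X in measurable X]setTI.
  exact: (measurable_trajectory (noise_measurable n2.1)).
move=> /(ae_probability1 P1 mN1) A1; apply/(ae_probability1 P2 mN2).
by rewrite -A1; apply/esym; exact: (driving_noise_same_law n1 n2 mA).
Qed.

Section process.
Context d (Omega : measurableType d) (P : probability Omega R).
Variable N : nat -> Omega -> borel Sigma.
Hypothesis noiseN : driving_noise mu P N.

Let mN := noise_measurable noiseN.1.

(** Phi_j for j > k is built from the noise before k only, so the past of the
process (Phi x, N) reduces to the past of the noise. *)
Lemma Phi_process_past x k :
  past (Phi_process mul act N (fun=> x)) N k `<=`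
  sigma_of (trajectory (fun j => N (k.+1 + j)%N) :
    Omega -> sequence_space (borel Sigma)).
Proof.
apply: smallest_sub; first exact/sigma_algebra_preimage/sigma_algebra_measurable.
move=> A [j kj [] [C mC <-]]; rewrite setTI.
  pose f (s : sequence_space (borel Sigma)) : borel S := act (Phi mul s (j - k.+1)) x.
  exists (f @^-1` C).
    rewrite -[X in measurable X]setTI; apply: (measurable_Phi_act (Y := id)) => //.
  rewrite setTI; apply/seteqP; split=> w;
    by rewrite /f /Phi_process /= (Phi_shift (trajectory N w)) subnKC.
exists ((fun u : sequence_space (borel Sigma) => u (j - k.+1)%N) @^-1` C).
  by rewrite -[X in measurable X]setTI; exact: measurable_coord.
by rewrite setTI; apply/seteqP; split=> w; rewrite /trajectory /= subnKC.
Qed.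

Hypothesis cvgN : forall k, {ae P, forall w,
  cvgn (backward_prod mul (trajectory N w) k)}.

Lemma Phi_process_strong_solution x :
  strong_solution act mu P (Phi_process mul act N (fun=> x)) N.
Proof.
split; first split.
- by move=> k; exact: measurable_Phi_process.
- exact: noiseN.1.
- move=> k A B [A' mA' <-] /Phi_process_past[C mC <-]; rewrite !setTI setIC muleC.
  have mN' j : measurable_fun setT (N (k.+1 + j)%N) by exact: mN.
  apply: (independent_rectangles mN') => //.
    by rewrite -[X in measurable X]setTI; exact: mN.
  by move=> D m mD; apply: mutually_independent_split => //; exact: noiseN.2.
- move=> k; apply: filterS2 (cvgN k) (cvgN k.+1) => w ck ck1.
  by rewrite /Phi_process Phi_step// actP.1.
move=> k; exists (fun s => act (Phi mul s 0) x); split.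
  exact: (measurable_Phi_act (Y := id)).
by apply: aeW => w; rewrite (Phi_shift (trajectory N w)) addn0.
Qed.

Definition equivalent x x' : Prop :=
  {ae P, forall w, forall k,
     act (Phi mul (trajectory N w) k) x = act (Phi mul (trajectory N w) k) x'}.

Let agree w : set (S * S) := [set p | forall k,
  act (Phi mul (trajectory N w) k) p.1 = act (Phi mul (trajectory N w) k) p.2].

Let closed_agree w : closed (agree w).
Proof.
rewrite (_ : agree w = \bigcap_k [set p : S * S |
    act (Phi mul (trajectory N w) k) p.1 = act (Phi mul (trajectory N w) k) p.2]).
  apply: closed_bigI => k _.
  exact: (closed_agreement hausdorffS (@continuous_act_r _)).
by apply/seteqP; split=> p agp k => [_|]; exact: agp.
Qed.

(** Since the null set does not depend on the pair of points, random points may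
be substituted for x and x'. *)
Lemma ae_equivalent : {ae P, forall w, forall x x', equivalent x x' ->
  forall k, act (Phi mul (trajectory N w) k) x = act (Phi mul (trajectory N w) k) x'}.
Proof.
have cSS := second_countable_prod countableS countableS.
apply: filterS (ae_subset_random_closed P cSS closed_agree) => w sub x x' xx'.
exact: (sub (x, x')).
Qed.

Lemma closed_equivalent : closed [set p : S * S | equivalent p.1 p.2].
Proof.
exact: (closed_ae_mem (P := P) (second_countable_prod countableS countableS) closed_agree).
Qed.

End process.

Lemma equivalent_transfer d1 (Omega1 : measurableType d1)
    (P1 : probability Omega1 R) (N1 : nat -> Omega1 -> borel Sigma)
    d2 (Omega2 : measurableType d2) (P2 : probability Omega2 R)
    (N2 : nat -> Omega2 -> borel Sigma) x x' :
  driving_noise mu P1 N1 -> driving_noise mu P2 N2 ->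
  equivalent P1 N1 x x' -> equivalent P2 N2 x x'.
Proof.
move=> n1 n2; apply: (driving_noise_ae (A := [set s | forall k,
  act (Phi mul s k) x = act (Phi mul s k) x'])) => //.
apply: (measurable_act_graph (Y := id) (X := fun=> x')
  (Z := fun k s => act (Phi mul s k) x)) => // k.
exact: (measurable_Phi_act (Y := id)).
Qed.

Lemma Phi_process_same_law d1 (Omega1 : measurableType d1)
    (P1 : probability Omega1 R) (N1 : nat -> Omega1 -> borel Sigma)
    d2 (Omega2 : measurableType d2) (P2 : probability Omega2 R)
    (N2 : nat -> Omega2 -> borel Sigma) x :
  driving_noise mu P1 N1 -> driving_noise mu P2 N2 ->
  equal_solutions P1 P2 (Phi_process mul act N1 (fun=> x)) N1
                        (Phi_process mul act N2 (fun=> x)) N2.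
Proof.
move=> n1 n2 A mA.
pose g (s : sequence_space (borel Sigma)) :
    sequence_space (borel S) * sequence_space (borel Sigma) :=
  ((fun k => act (Phi mul s k) x) : sequence_space (borel S), s).
have mg : measurable_fun setT g.
  apply: measurable_fun_pair => //.
  apply: (measurable_trajectory (E := borel S)
    (Y := fun k (s : sequence_space (borel Sigma)) => act (Phi mul s k) x)) => k.
  exact: (measurable_Phi_act (Y := id)).
apply: (driving_noise_same_law n1 n2 (A := g @^-1` A)).
by rewrite -[X in measurable X]setTI; exact: mg.
Qed.

Lemma driving_noise_cvg d1 (Omega1 : measurableType d1)
    (P1 : probability Omega1 R) (N1 : nat -> Omega1 -> borel Sigma)
    d2 (Omega2 : measurableType d2) (P2 : probability Omega2 R)
    (N2 : nat -> Omega2 -> borel Sigma) :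
  driving_noise mu P1 N1 -> driving_noise mu P2 N2 ->
  (forall k, {ae P1, forall w, cvgn (backward_prod mul (trajectory N1 w) k)}) ->
  {ae P2, forall w, forall k, cvgn (backward_prod mul (trajectory N2 w) k)}.
Proof.
move=> n1 n2 cvgN1; apply: ae_foralln => k.
apply: (driving_noise_ae n1 n2 (A := [set s | cvgn (backward_prod mul s k)])).
  by apply: measurable_cvgn => // m; exact: measurable_backward_prod.
exact: cvgN1.
Qed.

End driving_noises.

(** The pair (trajectory of Phi x, noise) lies on the graph of a measurable map
of the noise; a pair with the same law lies on it almost surely. *)
Lemma equal_solutions_equivalent d (Omega : measurableType d)
    (P : probability Omega R) (N : nat -> Omega -> borel Sigma) x x' :
  (forall k, measurable_fun setT (N k)) ->
  equal_solutions P P (Phi_process mul act N (fun=> x)) N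
                      (Phi_process mul act N (fun=> x')) N ->
  equivalent P N x' x.
Proof.
move=> mN eqs.
have mgraph := measurable_act_graph
  (@measurable_snd _ _ (sequence_space (borel S)) (sequence_space (borel Sigma)))
  (@measurable_cst _ _ _ (borel S) setT x)
  (fun k => measurableT_comp (@measurable_coord _ (borel S) k)
    (@measurable_fst _ _ (sequence_space (borel S)) (sequence_space (borel Sigma)))).
have magree y : measurable [set w | forall k,
    act (Phi mul (trajectory N w) k) y = act (Phi mul (trajectory N w) k) x].
  apply: measurable_act_graph => //; first exact: measurable_trajectory.
  by move=> k; apply: measurable_Phi_act => //; exact: measurable_trajectory.
apply/(ae_probability1 P (magree x')); apply: etrans (esym (eqs _ mgraph)) _.
by apply/(ae_probability1 P (magree x)); exact: aeW.
Qed.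

(** The initial point Z is independent of the noise, and X is a function f of
the noise; so f_k(N) = Phi_k Z almost surely forces f_k(N) = Phi_k x almost
surely for some deterministic x. *)
Lemma strong_solution_constant (mu : nat -> probability (borel Sigma) R)
    d (Omega : measurableType d) (P : probability Omega R)
    (X : nat -> Omega -> borel S) (N : nat -> Omega -> borel Sigma) :
  strong_solution act mu P X N ->
  {ae P, forall w, forall k, cvgn (backward_prod mul (trajectory N w) k)} ->
  exists x, {ae P, forall w, forall k,
    X k w = act (Phi mul (trajectory N w) k) x}.
Proof.
move=> [sol strong] cvgN.
have mN := noise_measurable (solution_law sol).
have [Z [mZ indepZ XZ]] := solution_initial sol cvgN.
have /choice[f fP] := strong.
pose A := [set p : borel S * sequence_space (borel Sigma) | forall k,
  f k (fun j => p.2 (k + j)%N) = act (Phi mul p.2 k) p.1].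
have mA : measurable A.
  apply: measurable_act_graph => // k.
  apply: (measurableT_comp (fP k).1).
  apply: (measurable_trajectory (E := borel Sigma)
    (Y := fun j (p : borel S * sequence_space (borel Sigma)) => p.2 (k + j)%N)) => j.
  exact: (measurableT_comp (@measurable_coord _ (borel Sigma) (k + j))).
have Xf : {ae P, forall w, forall k, X k w = f k (fun j => N (k + j)%N w)}.
  by apply: ae_foralln => k; exact: (fP k).2.
have [x Ax] : exists x, {ae P, forall w, A (x, trajectory N w)}.
  apply: (ae_independent_section mZ (measurable_trajectory mN) indepZ mA).
  by apply: filterS2 XZ Xf => w Xw fw k; rewrite /= -fw.
by exists x; apply: filterS2 Xf Ax => w fw Aw k; rewrite fw; exact: Aw.
Qed.

End equation.

(** * Classification of the solutions *)

Theorem theorem1p1 (R : realType) (S Sigma : pmetricType R)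
    (compact_S : compact [set: S]) (countable_base_S : @second_countable S)
    (compact_Sigma : compact [set: Sigma])
    (countable_base_Sigma : @second_countable Sigma)
    (mul : Sigma -> Sigma -> Sigma) (act : Sigma -> S -> S)
    (mul_semigroup : topological_semigroup mul)
    (act_action : continuous_action mul act)
    (mu : nat -> probability (borel Sigma) R)
    (d : measure_display) (Omega : measurableType d) (P : probability Omega R)
    (N : nat -> Omega -> borel Sigma) (noise_N : driving_noise mu P N)
    (cvg_products : forall k, {ae P, forall w,
       cvgn (backward_prod mul (trajectory N w) k)}) :
  (forall x : S,
     strong_solution act mu P (Phi_process mul act N (fun=> x)) N) /\
  exists (T : ptopologicalType) (pi : S -> T) (psi : borel T -> borel S),
    [/\ compact [set: T], hausdorff_space T & @second_countable T] /\
    [/\ continuous pi, (forall y, exists x, pi x = y),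
        measurable_fun setT psi & (forall y, pi (psi y) = y)] /\
    [/\
      forall y1 y2 : T, y1 <> y2 ->
        ~ equal_solutions P P (Phi_process mul act N (fun=> psi y1)) N
                              (Phi_process mul act N (fun=> psi y2)) N,
      forall (d1 : measure_display) (Omega1 : measurableType d1)
          (P1 : probability Omega1 R) (X1 : nat -> Omega1 -> borel S)
          (N1 : nat -> Omega1 -> borel Sigma),
        strong_solution act mu P1 X1 N1 ->
        exists y : T,
          equal_solutions P1 P X1 N1 (Phi_process mul act N (fun=> psi y)) N
    &
      forall (d1 : measure_display) (Omega1 : measurableType d1)
          (P1 : probability Omega1 R) (X1 : nat -> Omega1 -> borel S)
          (N1 : nat -> Omega1 -> borel Sigma),
        solution act mu P1 X1 N1 ->
        exists (d2 : measure_display) (Omega2 : measurableType d2)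
            (P2 : probability Omega2 R) (N2 : nat -> Omega2 -> borel Sigma)
            (Xi : Omega2 -> borel T),
          [/\ driving_noise mu P2 N2,
              measurable_fun setT Xi,
              independent_classes P2 (sigma_of Xi)
                (sigma_of (trajectory N2 : Omega2 -> sequence_space (borel Sigma))) &
              equal_solutions P1 P2 X1 N1
                (Phi_process mul act N2 (psi \o Xi)) N2]].
Proof.
have hS : hausdorff_space S := @metric_hausdorff R S.
have mN := noise_measurable noise_N.1.
split; first by move=> x; exact: (@Phi_process_strong_solution R S Sigma).
pose e := equivalent mul act P N.
have e_refl x : e x x by apply: aeW.
have e_sym x y : e x y -> e y x by apply: filterS => w xy k.
have e_trans x y z : e x y -> e y z -> e x z.
  by apply: filterS2 => w xy yz k; rewrite xy.
have [T [pi [[cT hT scT] [cpi spi piE]]]] := compact_quotient R compact_S hS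
  countable_base_S e_refl e_sym e_trans
  (closed_equivalent (N := N) (P := P) countable_base_S act_action).
have [psi [mpsi psiK]] :=
  measurable_section compact_S hS countable_base_S hT cpi spi.
exists T, pi, psi; split=> //; split=> //.
have e_psi_pi x : e x (psi (pi x)) by apply/piE.
(* the initial point of any solution can be moved inside its class *)
have equal_psi d1 (Omega1 : measurableType d1) (P1 : probability Omega1 R)
    (X1 : nat -> Omega1 -> borel S) (N1 : nat -> Omega1 -> borel Sigma)
    (Z : Omega1 -> borel S) :
    solution act mu P1 X1 N1 -> measurable_fun setT (psi \o pi \o Z) ->
    {ae P1, forall w, forall k,
       X1 k w = act (Phi mul (trajectory N1 w) k) (Z w)} ->
    equal_solutions P1 P1 X1 N1 (Phi_process mul act N1 (psi \o pi \o Z)) N1.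
  move=> sol mZ XZ; have noise_N1 := solution_driving_noise sol.
  have mN1 := noise_measurable noise_N1.1.
  apply: ae_equal_solutions => //.
  - exact: solution_measurable sol.
  - by move=> k; apply: measurable_Phi_process.
  have aeE := ae_equivalent countable_base_S act_action P1 N1.
  apply: filterS2 XZ aeE => w Xw ew k; rewrite Xw; apply: ew.
  by apply: equivalent_transfer noise_N noise_N1 _ => //; exact: e_psi_pi.
split.
- move=> y1 y2 y12 eqs; apply: y12; rewrite -[y1]psiK -[y2]psiK.
  by apply: (piE _ _).2; apply: e_sym; apply: equal_solutions_equivalent eqs.
- move=> d1 Omega1 P1 X1 N1 strong; have sol := strong.1.
  have noise_N1 := solution_driving_noise sol.
  have cvg_N1 := driving_noise_cvg compact_Sigma countable_base_Sigma
    mul_semigroup noise_N noise_N1 cvg_products.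
  have [x Xx] := strong_solution_constant compact_S countable_base_S compact_Sigma
    countable_base_Sigma mul_semigroup act_action strong cvg_N1.
  exists (pi x) => A mA.
  rewrite (equal_psi _ _ _ _ _ (fun=> x) sol _ Xx A mA).
    exact: (Phi_process_same_law _ _ _ _ _ _ noise_N1 noise_N mA).
  exact: measurable_cst.
move=> d1 Omega1 P1 X1 N1 sol.
have noise_N1 := solution_driving_noise sol.
have cvg_N1 := driving_noise_cvg compact_Sigma countable_base_Sigma
  mul_semigroup noise_N noise_N1 cvg_products.
have [Z [mZ indepZ XZ]] :=
  solution_initial compact_S countable_base_S act_action sol cvg_N1.
have mpi : measurable_fun setT (pi : borel S -> borel T).
  apply: measurable_open => U oU; apply: sub_sigma_algebra.
  exact: (continuousP _).1.
have mpiZ : measurable_fun setT (pi \o Z : Omega1 -> borel T).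
  exact: measurableT_comp.
exists d1, Omega1, P1, N1, (pi \o Z); split=> //.
  move=> A B [A' mA' <-] [B' mB' <-]; rewrite !setTI.
  apply: (indepZ (pi @^-1` A') B' _ mB').
  by rewrite -[X in measurable X]setTI; exact: mpi.
by apply: (equal_psi _ _ _ _ _ Z) => //; exact: (measurableT_comp mpsi mpiZ).
Qed.
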